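(* Let $M$ be a sub-Riemannian manifold and $L:\mathcal D\to\mathbb R$ a Lagrangian which is $C^2$, uniformly superlinear, uniformly bounded and strictly convex (in the sense of the context). For every $\lambda>0$ the discounted value function $u_\lambda$ has the following properties: (1) $\inf_{\mathcal D}L\le\lambda u_\lambda\le A(0)$ on $M$, where $A(0)=\sup\{L(v):\|v\|=0\}$; (2) for any $a<b$ and any $\alpha\in W^{1,1}_{\mathcal D}([a,b])$, $$u_\lambda(\alpha(b))e^{\lambda b}-u_\lambda(\alpha(a))e^{\lambda a}\le A_{L,\lambda}(\alpha).$$
   Context: $(M,\mathcal D,\langle\cdot,\cdot\rangle)$ is a sub-Riemannian manifold: $M$ is a connected smooth manifold, $\mathcal D\subset TM$ is a smooth bracket-generating distribution with a smoothly varying inner product and norm $\|\cdot\|$ on its fibers. A continuous curve $\gamma:[a,b]\to M$ is absolutely continuous if $\varphi\circ\gamma$ is absolutely continuous for every smooth compactly supported $\varphi:M\to\mathbb R$; it is horizontal if $\dot\gamma(t)\in\mathcal D$ for a.e. $t$. $W^{1,1}_{\mathcal D}([a,b])$ is the set of horizontal absolutely continuous curves on $[a,b]$; for an unbounded interval the condition is required on each compact subinterval. The Lagrangian $L:\mathcal D\to\mathbb R$ is $C^2$ and satisfies: (uniform superlinearity) for all $K\ge 0$ there is $C(K)\in\mathbb R$ with $L(v)\ge K\|v\|+C(K)$ for all $v\in\mathcal D$; (uniform boundedness) for all $R\ge 0$, $A(R)=\sup\{L(v):\|v\|\le R\}<+\infty$; (strict convexity) there is $a_0>0$ with $\partial^2_{vv}L(v)(w,w)\ge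 a_0$ for all $v,w\in\mathcal D$ in the same fiber with $\|w\|=1$. $A_{L,\lambda}(\gamma)=\int_a^be^{\lambda t}L(\dot\gamma(t))\,dt$. $u_\lambda(x)=\inf\int_{-\infty}^0e^{\lambda t}L(\dot\gamma(t))\,dt$ over $\gamma\in W^{1,1}_{\mathcal D}(]-\infty,0])$ with $\gamma(0)=x$. *)

(* Defs.v *)
From HB Require Import structures.
From mathcomp Require Import all_boot all_order all_algebra.
From mathcomp Require Import all_classical all_reals all_analysis.

Set Implicit Arguments.
Unset Strict Implicit.
Unset Printing Implicit Defensive.

Import Order.TTheory GRing.Theory Num.Theory.
Import numFieldNormedType.Exports.

Local Open Scope classical_set_scope.
Local Open Scope ring_scope.

(** * Functions of class C^k on open subsets of R^n *)

(* Meaningful for [U] open: then the values of [f] outside [U] are irrelevant. *)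
Fixpoint Ck_on (R : realType) (n k : nat) (U : set 'rV[R]_n)
    (f : 'rV[R]_n -> R) : Prop :=
  {in U, continuous f} /\
  if k is k'.+1 then
    forall i : 'I_n,
      (forall x, U x -> derivable f x (delta_mx 0 i)) /\
      Ck_on k' U (fun x => 'D_(delta_mx 0 i) f x)
  else True.

Definition Coo_on (R : realType) (n : nat) (U : set 'rV[R]_n)
    (f : 'rV[R]_n -> R) : Prop :=
  forall k, Ck_on k U f.

(** * Smooth manifolds *)

(* A homeomorphism from the open set [cdom] onto the open set [ccod], both
   directions being represented by total functions. *)
Record chart (R : realType) (n : nat) (M : topologicalType) := Chart {
  cdom : set M;
  ccod : set 'rV[R]_n;
  cmap : M -> 'rV[R]_n;
  cinv : 'rV[R]_n -> M;
  cdom_open : open cdom;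
  ccod_open : open ccod;
  cmap_cod : forall x, cdom x -> ccod (cmap x);
  cinv_dom : forall z, ccod z -> cdom (cinv z);
  cmapK : forall x, cdom x -> cinv (cmap x) = x;
  cinvK : forall z, ccod z -> cmap (cinv z) = z;
  cmap_continuous : {in cdom, continuous cmap};
  cinv_continuous : {in ccod, continuous cinv} }.

Record smooth_structure (R : realType) (n : nat) (M : topologicalType) :=
  SmoothStructure {
  atlas : set (chart R n M);
  manifold_hausdorff : hausdorff_space M;
  manifold_second_countable : @second_countable M;
  atlas_cover : forall x, exists2 c, atlas c & cdom c x;
  atlas_compatible : forall c1 c2, atlas c1 -> atlas c2 -> forall j : 'I_n,
    Coo_on (ccod c1 `&` cinv c1 @^-1` cdom c2)
           (fun z => cmap c2 (cinv c1 z) 0 j) }.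

Section Manifold.
Context {R : realType} {n : nat} {M : topologicalType}.
Variable S : smooth_structure R n M.

Definition smooth_on (U : set M) (f : M -> R) : Prop :=
  forall c, atlas S c -> Coo_on (ccod c `&` cinv c @^-1` U) (f \o cinv c).

Definition smooth (f : M -> R) : Prop := smooth_on setT f.

Definition compactly_supported (f : M -> R) : Prop :=
  compact (closure [set x | f x != 0]).

(* Tangent vectors at [x] are the derivations at [x] of the algebra of smooth
   functions.  They are extended by 0 to the non-smooth functions, so that
   equality of functionals is equality of derivations. *)
Definition tangent (x : M) (v : (M -> R) -> R) : Prop :=
  [/\ forall f, ~ smooth f -> v f = 0,
      forall (a : R) f g, smooth f -> smooth g ->
        v (fun y => a * f y + g y) = a * v f + v g
    & forall f g, smooth f -> smooth g ->
        v (fun y => f y * g y) = f x * v g + g x * v f].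

(* Vector fields on an open set [U]; the values outside [U] are irrelevant. *)
Definition smooth_vf_on (U : set M) (X : M -> (M -> R) -> R) : Prop :=
  (forall x, U x -> tangent x (X x)) /\
  (forall f, smooth f -> smooth_on U (fun x => X x f)).

Definition lie_bracket (X Y : M -> (M -> R) -> R) : M -> (M -> R) -> R :=
  fun x f => X x (fun y => Y y f) - Y x (fun y => X y f).

(** * Distributions *)

Definition local_frame (r : nat) (D : M -> set ((M -> R) -> R)) (U : set M)
    (X : 'I_r -> M -> (M -> R) -> R) : Prop :=
  (forall i, smooth_vf_on U (X i)) /\
  (forall x, U x ->
     D x = [set \sum_i u i *: X i x | u in [set: 'I_r -> R]] /\
     (forall u : 'I_r -> R, \sum_i u i *: X i x = 0 -> forall i, u i = 0)).

Definition smooth_distribution (r : nat) (D : M -> set ((M -> R) -> R)) : Prop :=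
  forall x, exists U, exists X : 'I_r -> M -> (M -> R) -> R,
    [/\ open U, U x & local_frame D U X].

(* The Lie algebra generated by the global smooth sections of [D]. *)
Inductive lie_hull (D : M -> set ((M -> R) -> R)) :
    (M -> (M -> R) -> R) -> Prop :=
| lie_hull_section X : smooth_vf_on setT X -> (forall x, D x (X x)) ->
    lie_hull D X
| lie_hull_lin (a : R) X Y : lie_hull D X -> lie_hull D Y ->
    lie_hull D (fun x => a *: X x + Y x)
| lie_hull_bracket X Y : lie_hull D X -> lie_hull D Y ->
    lie_hull D (lie_bracket X Y).

Definition bracket_generating (D : M -> set ((M -> R) -> R)) : Prop :=
  forall x v, tangent x v -> exists2 X, lie_hull D X & X x = v.

Record sub_riemannian (r : nat) := SubRiemannian {
  sr_connected : connected [set: M];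
  sr_dist : M -> set ((M -> R) -> R);
  sr_dist_smooth : smooth_distribution r sr_dist;
  sr_dist_bracket : bracket_generating sr_dist;
  (* only the values of [sr_inner x] on the fiber [sr_dist x] are relevant *)
  sr_inner : M -> ((M -> R) -> R) -> ((M -> R) -> R) -> R;
  sr_inner_sym : forall x v w, sr_dist x v -> sr_dist x w ->
    sr_inner x v w = sr_inner x w v;
  sr_inner_lin : forall x (a : R) v1 v2 w,
    sr_dist x v1 -> sr_dist x v2 -> sr_dist x w ->
    sr_inner x (a *: v1 + v2) w = a * sr_inner x v1 w + sr_inner x v2 w;
  sr_inner_pos : forall x v, sr_dist x v -> v != 0 -> 0 < sr_inner x v v;
  sr_inner_smooth : forall U X Y, open U ->
    smooth_vf_on U X -> smooth_vf_on U Y ->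
    (forall x, U x -> sr_dist x (X x)) -> (forall x, U x -> sr_dist x (Y x)) ->
    smooth_on U (fun x => sr_inner x (X x) (Y x)) }.

Definition sr_norm (r : nat) (Q : sub_riemannian r) (x : M)
    (v : (M -> R) -> R) : R :=
  Num.sqrt (sr_inner Q x v v).

(** * Horizontal curves *)

Definition abs_cont (a b : R) (f : R -> R) : Prop :=
  forall e : R, 0 < e -> exists2 d : R, 0 < d &
    forall (m : nat) (s t : 'I_m -> R),
      (forall i, a <= s i /\ s i <= t i /\ t i <= b) ->
      (forall i j, i != j -> `]s i, t i[ `&` `]s j, t j[ = set0) ->
      \sum_i (t i - s i) < d ->
      \sum_i `|f (t i) - f (s i)| < e.

Definition abs_cont_curve (a b : R) (c : R -> M) : Prop :=
  {within `[a, b], continuous c} /\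
  forall f, smooth f -> compactly_supported f -> abs_cont a b (f \o c).

(* The velocity of [c] at [t], a tangent vector at [c t] as soon as
   [curve_derivable c t] holds. *)
Definition velocity (c : R -> M) (t : R) : (M -> R) -> R :=
  fun f => if `[< smooth f >] then derive1 (f \o c) t else 0.

Definition curve_derivable (c : R -> M) (t : R) : Prop :=
  forall f, smooth f -> derivable (f \o c) t 1.

Section Lagrangian.
Context {r : nat}.
Variable Q : sub_riemannian r.

(* W^{1,1}_D([a,b]) *)
Definition W11 (a b : R) (c : R -> M) : Prop :=
  abs_cont_curve a b c /\
  {ae @lebesgue_measure R, forall t, t \in `[a, b] ->
     curve_derivable c t /\ sr_dist Q (c t) (velocity c t)}.

(* W^{1,1}_D(I) for an arbitrary interval [I] *)
Definition W11_loc (I : set R) (c : R -> M) : Prop :=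
  forall a b, a < b -> `[a, b] `<=` I -> W11 a b c.

(* A Lagrangian is a function of a base point [x] and of a vector in the fiber
   [sr_dist Q x]; its other values are irrelevant. *)
Variable L : M -> ((M -> R) -> R) -> R.

(* [L] is C^2 on the total space of the distribution, in the vector bundle
   coordinates given by a chart and a local frame. *)
Definition lagrangian_C2 : Prop :=
  forall (c : chart R n M) (U : set M) (X : 'I_r -> M -> (M -> R) -> R),
    atlas S c -> open U -> local_frame (sr_dist Q) U X ->
    Ck_on 2 [set z : 'rV[R]_(n + r) |
               ccod c (lsubmx z) /\ U (cinv c (lsubmx z))]
      (fun z => let x := cinv c (lsubmx z) in
                L x (\sum_(i < r) rsubmx z 0 i *: X i x)).

Definition uniformly_superlinear : Prop :=
  forall K : R, 0 <= K -> exists C : R,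
    forall x v, sr_dist Q x v -> K * sr_norm Q x v + C <= L x v.

(* A(rho) *)
Definition lagrangian_sup (rho : R) : \bar R :=
  ereal_sup [set y | exists x v,
    [/\ sr_dist Q x v, sr_norm Q x v <= rho & y = (L x v)%:E]].

Definition uniformly_bounded : Prop :=
  forall rho : R, 0 <= rho -> (lagrangian_sup rho < +oo)%E.

(* The second derivative of [L] along the fiber over [x]. *)
Definition fiber_hessian (x : M) (v w1 w2 : (M -> R) -> R) : R :=
  derive1 (fun s : R => derive1 (fun q : R => L x (v + s *: w1 + q *: w2)) 0) 0.

Definition strictly_convex : Prop :=
  exists2 a0 : R, 0 < a0 &
    forall x v w, sr_dist Q x v -> sr_dist Q x w -> sr_norm Q x w = 1 ->
      a0 <= fiber_hessian x v w w.

(* The integral over [I] of e^{lambda t} L(c'(t)).  On a null set of times the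
   velocity may fail to lie in the distribution, and the integrand is then only
   almost everywhere equal to a Borel function: this does not affect the value
   of the integral, a difference of two suprema over simple functions. *)
Definition discounted_action (lambda : R) (I : set R) (c : R -> M) : \bar R :=
  \int[@lebesgue_measure R]_(t in I)
    (expR (lambda * t) * L (c t) (velocity c t))%:E.

Definition value_function (lambda : R) (x : M) : \bar R :=
  ereal_inf [set discounted_action lambda `]-oo, 0] c |
    c in [set c : R -> M | W11_loc `]-oo, 0] c /\ c 0 = x]].

End Lagrangian.
End Manifold.

(* Main.v *)
Require Import Defs.
From HB Require Import structures.
From mathcomp Require Import all_boot all_order all_algebra.
From mathcomp Require Import all_classical all_reals all_analysis.
From mathcomp Require Import measurable_realfun lra.
Import Order.TTheory GRing.Theory Num.Theory.
Import numFieldNormedType.Exports.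
Local Open Scope classical_set_scope.
Local Open Scope ring_scope.

(** Write [u] for the value function.

    The bounds (1).  Along a horizontal curve ending at time 0 the integrand is
    at least [expR (lambda * t) * inf L] almost everywhere, and the weight
    [expR (lambda * t)] has integral [lambda^-1] over the negative half-line
    ([integral_expR_Ny0]); hence [inf L / lambda] is below every action, and
    below [u] ([le_value_function]).  The constant curve at [x] competes for
    [u x], and its velocity is 0, a vector of norm 0 ([value_function_le]).
    Superlinearity with slope 0 bounds [L] below and so makes [u] finite.

    The inequality (2) is dynamic programming.  Given a competitor [gamma] for
    [u (alpha a)], let it run until time [a - b] and then follow [alpha],
    translated so as to end at time 0: this is a competitor for [u (alpha b)].
    A translation in time by [k] multiplies the discounted action by
    [expR (- (lambda * k))] ([discounted_action_shift]), so that
      [u (alpha b) <= expR (- (lambda * (b - a))) * A gamma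
                      + expR (- (lambda * b)) * A alpha]
    ([discounted_action_concat]).  Multiply by [expR (lambda * b)] and take the
    infimum over [gamma].

    Two points need care.  First, the integrand of an action is a function of
    the velocity, whose measurability would require a study of [L] in local
    frames.  It is avoided: the integral of an arbitrary function is defined as
    the difference of the lower integrals of its positive and negative parts,
    and lower integrals are monotone up to null sets, additive in the domain and
    equivariant under translation and positive scaling, without any
    measurability of the integrand.  Each of these facts is obtained by
    transferring the measurable minorants.  As [L] is bounded below, the
    negative parts have finite integrals and the two lower integrals can be
    recombined.  Secondly, the concatenated curve must be shown to be horizontal
    and absolutely continuous: absolute continuity is local in time, by cutting
    at the junction each interval of a finite disjoint family, and velocities
    agree with those of the translated pieces except at the junction and the end
    points, which form a null set. *)

Set Implicit Arguments.
Unset Strict Implicit.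
Unset Printing Implicit Defensive.

(* Statements about almost every time mention the bare set function
   [lebesgue_measure]; inference of the filter instance needs its measure
   structure, given here explicitly. *)
#[local] Instance lebesgue_ae_filter (R : realType) :
  Filter (nbhs (almost_everywhere (@lebesgue_measure R))).
Proof. exact: (ae_filter_ringOfSetsType (@lebesgue_measure R)). Qed.

(** * Integrals of arbitrary functions *)

Section RawIntegral.
Context d (T : measurableType d) (R : realType).
Variable mu : {measure set T -> \bar R}.
Local Open Scope ereal_scope.

Import HBNNSimple.

(** The integral of a nonnegative function is by definition the supremum of the
    integrals of its simple minorants; those are measurable, so the theory of
    the measurable integral applies to each of them. *)
Lemma ge0_integral_le_minorants (f : T -> \bar R) (z : \bar R) :
  (forall x, 0 <= f x) ->
  (forall h : T -> R, measurable_fun setT h -> (forall x, 0 <= h x)%R ->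
     (forall x, (h x)%:E <= f x) -> \int[mu]_x (h x)%:E <= z) ->
  \int[mu]_x f x <= z.
Proof.
move=> f0 hz; rewrite ge0_integralTE//; apply: ge_ereal_sup => _ [h /= hf <-].
by rewrite -integralT_nnsfun; exact: hz.
Qed.

Lemma ge0_le_lower_integral (f h : T -> \bar R) :
  (forall x, 0 <= h x) -> (forall x, h x <= f x) ->
  \int[mu]_x h x <= \int[mu]_x f x.
Proof.
move=> h0 hf; have f0 x : 0 <= f x by exact: le_trans (hf x).
rewrite !ge0_integralTE//; apply: le_ereal_sup => _ [g /= gh <-].
by exists g => // x; exact: le_trans (hf x).
Qed.

(** A minorant of [f] becomes a minorant of [g] once it is set to 0 on the
    exceptional null set, which does not change its integral. *)
Lemma ae_ge0_le_lower_integral (D : set T) (f g : T -> \bar R) :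
  (forall x, 0 <= f x) -> (forall x, 0 <= g x) ->
  {ae mu, forall x, D x -> f x <= g x} ->
  \int[mu]_(x in D) f x <= \int[mu]_(x in D) g x.
Proof.
move=> f0 g0 [N [mN N0 sN]].
rewrite integral_mkcond [leRHS]integral_mkcond.
apply: ge0_integral_le_minorants => [x|h mh h0 hf]; first exact: erestrict_ge0.
rewrite (ge0_negligible_integral mN)//; last 2 first.
- exact/measurable_EFinP.
- by move=> x _; rewrite lee_fin.
rewrite integral_mkcond; apply: ge0_le_lower_integral => x.
  by apply: erestrict_ge0 => y _; rewrite lee_fin.
rewrite patchE; case: ifPn => [|_]; last exact: erestrict_ge0.
rewrite inE => -[_ /= Nx]; apply: (le_trans (hf x)); rewrite !patchE.
case: ifPn => // /set_mem Dx; apply: contrapT => fg; apply: Nx; apply: sN.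
by move=> /(_ Dx).
Qed.

Lemma ae_le_integral (D : set T) (f g : T -> \bar R) :
  {ae mu, forall x, D x -> f x <= g x} ->
  \int[mu]_(x in D) f x <= \int[mu]_(x in D) g x.
Proof.
move=> fg; rewrite integralE [leRHS]integralE; apply: leeB.
- apply: ae_ge0_le_lower_integral => //; apply: filterS fg => x fg Dx.
  by rewrite !funeposE ge_max !le_max fg// lexx orbT.
- apply: ae_ge0_le_lower_integral => //; apply: filterS fg => x fg Dx.
  by rewrite !funenegE ge_max !le_max leeN2 fg// lexx orbT.
Qed.

Lemma ae_eq_lower_integral (D : set T) (f g : T -> \bar R) :
  {ae mu, forall x, D x -> f x = g x} ->
  \int[mu]_(x in D) f x = \int[mu]_(x in D) g x.
Proof.
by move=> fg; apply/le_anti/andP; split; apply: ae_le_integral;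
  apply: filterS fg => x fg Dx; rewrite fg.
Qed.

(** A minorant on the union restricts to a minorant on each part, and minorants
    on the two disjoint parts add up to one on the union. *)
Lemma ge0_lower_integral_setU (A B : set T) (f : T -> \bar R) :
  measurable A -> measurable B -> [disjoint A & B] -> (forall x, 0 <= f x) ->
  \int[mu]_(x in A `|` B) f x =
  \int[mu]_(x in A) f x + \int[mu]_(x in B) f x.
Proof.
move=> mA mB AB f0; apply/le_anti/andP; split.
  rewrite [leLHS]integral_mkcond.
  apply: ge0_integral_le_minorants => [x|h mh h0 hf].
    exact: erestrict_ge0.
  have hAB : \int[mu]_x (h x)%:E = \int[mu]_(x in A `|` B) (h x)%:E.
    rewrite [RHS]integral_mkcond; apply: eq_integral => x _.
    rewrite patchE; case: ifPn => // xAB; apply/le_anti/andP; split.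
      by have := hf x; rewrite patchE (negbTE xAB).
    by rewrite lee_fin.
  have le C : C `<=` A `|` B ->
      \int[mu]_(x in C) (h x)%:E <= \int[mu]_(x in C) f x.
    move=> CAB; apply: ae_le_integral; apply: aeW => x Cx.
    by apply: (le_trans (hf x)); rewrite patchE mem_set//; exact: CAB.
  rewrite hAB ge0_integral_setU//; last 2 first.
  - exact/measurable_EFinP/measurable_funTS.
  - by move=> x _; rewrite lee_fin.
  by apply: leeD; apply: le; [exact: subsetUl|exact: subsetUr].
set Z := (X in _ <= X); have [->|Zfin] := eqVneq Z +oo; first exact: leey.
have le C : C `<=` A `|` B -> \int[mu]_(x in C) f x <= Z.
  move=> CAB; rewrite /Z integral_mkcond [leRHS]integral_mkcond.
  apply: ge0_le_lower_integral => x; first exact: erestrict_ge0.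
  rewrite !patchE; case: ifPn => [/set_mem/CAB/mem_set ->//|_].
  by case: ifPn.
have Z0 : 0 <= Z by exact: integral_ge0.
have Zf : Z \is a fin_num by rewrite ge0_fin_numE// ltey.
have fin x : 0 <= x -> x <= Z -> x \is a fin_num.
  by move=> x0 xZ; rewrite ge0_fin_numE// (le_lt_trans xZ)// ltey.
have fA : \int[mu]_(x in A) f x \is a fin_num.
  by apply: fin; [exact: integral_ge0|apply: le; exact: subsetUl].
rewrite addeC -leeBrDr//.
rewrite integral_mkcond; apply: ge0_integral_le_minorants => [x|h mh h0 hf].
  exact: erestrict_ge0.
have fh : \int[mu]_x (h x)%:E \is a fin_num.
  apply: fin; first by apply: integral_ge0 => x _; rewrite lee_fin.
  apply: le_trans (le B _); last exact: subsetUr.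
  rewrite [leRHS]integral_mkcond; apply: ge0_le_lower_integral => //.
rewrite leeBrDr// addeC -leeBrDr// integral_mkcond.
apply: ge0_integral_le_minorants => [x|g mg g0 gf]; first exact: erestrict_ge0.
rewrite leeBrDr// -ge0_integralD//; last 4 first.
- by move=> x _; rewrite lee_fin.
- exact/measurable_EFinP.
- by move=> x _; rewrite lee_fin.
- exact/measurable_EFinP.
rewrite /Z [leRHS]integral_mkcond; apply: ge0_le_lower_integral => x.
  by rewrite adde_ge0// lee_fin.
apply: le_trans (leeD (gf x) (hf x)) _; rewrite !patchE in_setU.
have [xA|xA] := boolP (x \in A); have [xB|xB] := boolP (x \in B) => //=.
- by move/disj_setPS : AB => /(_ x); case; split; exact: set_mem.
- by rewrite adde0.
- by rewrite add0e.
- by rewrite adde0.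
Qed.

(** The finiteness condition rules out the difference of two infinite
    integrals. *)
Lemma lower_integral_setU (A B : set T) (f : T -> \bar R) :
  measurable A -> measurable B -> [disjoint A & B] ->
  \int[mu]_(x in A `|` B) (f^\- x) < +oo ->
  \int[mu]_(x in A `|` B) f x =
  \int[mu]_(x in A) f x + \int[mu]_(x in B) f x.
Proof.
move=> mA mB AB; rewrite (integralE _ _ f) (integralE _ A f) (integralE _ B f).
rewrite !ge0_lower_integral_setU// => nfin.
have fin C : \int[mu]_(x in C) f^\- x <=
    \int[mu]_(x in A) (f^\- x) + \int[mu]_(x in B) (f^\- x) ->
    \int[mu]_(x in C) f^\- x \is a fin_num.
  move=> le; rewrite ge0_fin_numE; last exact: integral_ge0.
  exact: (le_lt_trans le nfin).
have nA : \int[mu]_(x in A) f^\- x \is a fin_num.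
  by apply: fin; rewrite leeDl// integral_ge0.
have nB : \int[mu]_(x in B) f^\- x \is a fin_num.
  by apply: fin; rewrite leeDr// integral_ge0.
by rewrite fin_num_oppeD// addeACA.
Qed.

End RawIntegral.

(** * Translation and scaling of the Lebesgue integral *)

Section Translation.
Context {R : realType}.

Local Open Scope ereal_scope.
Local Notation mu := (@lebesgue_measure R).

Lemma measurable_shift (k : R) :
  measurable_fun setT (shift k : measurableTypeR R -> measurableTypeR R).
Proof. by apply: measurable_funD => //; exact: measurable_cst. Qed.

Lemma lebesgue_measure_shift (k : R) (A : set R) : measurable A ->
  mu (shift k @^-1` A) = mu A.
Proof.
have mk := measurable_shift k.
have shiftE (a b : R) :
    shift k @^-1` `]a, b] = `](a - k)%R, (b - k)%R]%classic.
  by apply/seteqP; split => x /=; rewrite !in_itv/= ltrBlDr lerBrDr.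
move=> mA; rewrite -[LHS]/(pushforward mu (shift k : R -> measurableTypeR R) A).
apply/esym/lebesgue_measure_unique => //= _ [[a b]] _ <-.
rewrite /pushforward shiftE !lebesgue_measure_itv/= !lte_fin ltrD2r.
by case: ifP => // _; rewrite -!EFinB opprB addrA subrK.
Qed.

Lemma ae_shift (k : R) (P : R -> Prop) :
  {ae mu, forall t, P t} -> {ae mu, forall t, P (t + k)%R}.
Proof.
move=> [N [mN N0 sN]]; exists (shift k @^-1` N); split.
- by rewrite -[X in measurable X]setTI; exact: measurable_shift.
- by rewrite -N0; exact: lebesgue_measure_shift.
- by move=> t; exact: sN.
Qed.

Lemma ae_neq (x : R) : {ae mu, forall t, t != x}.
Proof.
exists [set x]; split; [exact: measurable_set1|exact: lebesgue_measure_set1|].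
by move=> t /= /negP; rewrite negbK => /eqP.
Qed.

Lemma lower_integral_itv_obnd_cbnd (a b : R) (f : R -> \bar R) :
  \int[mu]_(t in `]a, b]) f t = \int[mu]_(t in `[a, b]) f t.
Proof.
rewrite integral_mkcond [RHS]integral_mkcond.
apply: ae_eq_lower_integral; apply: filterS (ae_neq a) => t ta _.
rewrite !patchE (_ : (t \in `]a, b]%classic) = (t \in `[a, b]%classic))//.
by apply/idP/idP; rewrite !inE/= !in_itv/= lt_neqAle eq_sym ta.
Qed.

Lemma ge0_measurable_integral_shift (k : R) (f : R -> R) :
  measurable_fun setT f -> (forall x, 0 <= f x)%R ->
  \int[mu]_x (f (x + k)%R)%:E = \int[mu]_x (f x)%:E.
Proof.
move=> mf f0.
rewrite -(preimage_setT (shift k : R -> measurableTypeR R)).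
rewrite -(@ge0_integral_pushforward _ _ _ _ _ _ (measurable_shift k)
  mu setT (EFin \o f))//.
- apply: eq_measure_integral => [|pf A mA _]; first exact: measurable_shift.
  exact: lebesgue_measure_shift.
- exact/measurable_EFinP.
- by move=> x _; rewrite lee_fin.
Qed.

(** If [h] is a minorant of [c * f (x + k)], then [c^-1 * h (x - k)] is one of
    [f]. *)
Lemma ge0_le_integral_affine (k c : R) (f : R -> \bar R) : (0 < c)%R ->
  (forall x, 0 <= f x) ->
  \int[mu]_x (c%:E * f (x + k)%R) <= c%:E * \int[mu]_x f x.
Proof.
move=> c0 f0; apply: ge0_integral_le_minorants => [x|/= h mh h0 hf].
  by rewrite mule_ge0// lee_fin ltW.
pose g x := (c^-1 * h (x - k))%R.
have mhk : measurable_fun setT (fun x : measurableTypeR R => h (x - k)%R).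
  by apply: measurableT_comp => //; exact: measurable_shift.
rewrite -(ge0_measurable_integral_shift (- k))//.
rewrite (_ : (fun x => _) = (fun x => c%:E * (g x)%:E)); last first.
  by apply/funext => x; rewrite /g -EFinM mulVKf// gt_eqF.
have g0 x : (0 <= g x)%R by rewrite mulr_ge0// invr_ge0 ltW.
rewrite ge0_integralZl_EFin//; last 3 first.
- by move=> x _; rewrite lee_fin.
- by apply/measurable_EFinP; exact: measurable_funM.
- exact: ltW.
rewrite lee_pmul2l//; apply: ge0_le_lower_integral => x; first by rewrite lee_fin.
rewrite /g -(lee_pmul2l _ (_ : 0 < c%:E))// -EFinM mulVKf ?gt_eqF//.
by apply: (le_trans (hf _)); rewrite subrK.
Qed.

(** The reverse inequality is [ge0_le_integral_affine] for the inverse affine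
    change, with [- k] and [c^-1]. *)
Lemma ge0_integral_affine (k c : R) (f : R -> \bar R) : (0 < c)%R ->
  (forall x, 0 <= f x) ->
  \int[mu]_x (c%:E * f (x + k)%R) = c%:E * \int[mu]_x f x.
Proof.
move=> c0 f0; apply/le_anti/andP; split; first exact: ge0_le_integral_affine.
have cV : (0 < c^-1)%R by rewrite invr_gt0.
rewrite -(@lee_pmul2l _ (c^-1)%:E)// muleA -EFinM mulVf ?gt_eqF// mul1e.
have g0 x : 0 <= c%:E * f (x + k)%R by rewrite mule_ge0// lee_fin ltW.
apply: le_trans (ge0_le_integral_affine (- k) cV g0).
rewrite le_eqVlt; apply/orP; left; apply/eqP; apply: eq_integral => x _.
by rewrite muleA -EFinM mulVf ?gt_eqF// mul1e subrK.
Qed.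

Lemma lower_integral_affine (k c : R) (D : set R) (f : R -> \bar R) :
  (0 < c)%R ->
  \int[mu]_(x in shift k @^-1` D) ((fun t => c%:E * f (t + k)%R)^\- x) < +oo ->
  \int[mu]_(x in shift k @^-1` D) (c%:E * f (x + k)%R) =
  c%:E * \int[mu]_(x in D) f x.
Proof.
move=> c0 nfin; rewrite integralE [in RHS]integralE.
have aff (g : R -> \bar R) : (forall x, 0 <= g x) ->
    \int[mu]_(x in shift k @^-1` D) (c%:E * g (x + k)%R) =
    c%:E * \int[mu]_(x in D) g x.
  move=> g0; rewrite [in RHS]integral_mkcond -(ge0_integral_affine k)//; last first.
    by move=> x; exact: erestrict_ge0.
  rewrite integral_mkcond; apply: eq_integral => x _; rewrite !patchE.
  rewrite (_ : (x \in shift k @^-1` D) = ((x + k)%R \in D)).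
    by case: ifP => //; rewrite mule0.
  by apply/idP/idP; rewrite !inE.
have pE x : (fun t => c%:E * f (t + k)%R)^\+ x = c%:E * f^\+ (x + k)%R.
  by rewrite !funeposE maxe_pMr ?lee_fin ?ltW// mule0.
have nE x : (fun t => c%:E * f (t + k)%R)^\- x = c%:E * f^\- (x + k)%R.
  by rewrite !funenegE maxe_pMr ?lee_fin ?ltW// mule0 muleN.
have Nfin : \int[mu]_(x in D) f^\- x \is a fin_num.
  rewrite ge0_fin_numE; last exact: integral_ge0.
  rewrite ltey; apply: contraTneq nfin => Noo.
  have -> : \int[mu]_(x in shift k @^-1` D)
      (fun t => c%:E * f (t + k)%R)^\- x = c%:E * \int[mu]_(x in D) f^\- x.
    by rewrite -aff//; apply: eq_integral => t _; exact: nE.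
  by rewrite Noo gt0_muley ?lte_fin// ltxx.
rewrite muleBr//; last by rewrite fin_num_adde_defl// fin_numN.
by rewrite -!aff//; congr (_ - _); apply: eq_integral => x _; rewrite ?pE ?nE.
Qed.

End Translation.

(** * Absolutely continuous functions on an interval *)

Section AbsCont.
Context {R : realType}.

Lemma abs_cont_sub (a b a' b' : R) (f : R -> R) : a <= a' -> b' <= b ->
  abs_cont a b f -> abs_cont a' b' f.
Proof.
move=> aa' bb' fac e /fac[d d0 H]; exists d => // m s t ab; apply: H => i.
have [as_ [st tb]] := ab i; split; first exact: le_trans as_.
by split => //; exact: le_trans bb'.
Qed.

Lemma eq_abs_cont (a b : R) (f g : R -> R) :
  (forall t, a <= t <= b -> f t = g t) -> abs_cont a b f -> abs_cont a b g.
Proof.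
move=> fg fac e /fac[d d0 H]; exists d => // m s t ab st std.
rewrite (eq_bigr (fun i => `|f (t i) - f (s i)|)); first exact: H.
move=> i _; have [as_ [sti tb]] := ab i.
by rewrite !fg// ?as_ ?tb ?(le_trans as_ sti) ?(le_trans sti tb).
Qed.

Lemma abs_cont_shift (k a b : R) (f : R -> R) :
  abs_cont a b f -> abs_cont (a - k) (b - k) (f \o shift k).
Proof.
move=> fac e /fac[d d0 H]; exists d => // m s t ab st std.
apply: (H m (shift k \o s) (shift k \o t)) => /=.
- move=> i; have [ais [sti tib]] := ab i.
  by split; [|split]; lra.
- move=> i j /st stij; apply/seteqP; split => // x [/=]; rewrite !in_itv/=.
  move=> /andP[xi ix] /andP[xj jx].
  suff : (`]s i, t i[ `&` `]s j, t j[) (x - k) by rewrite stij.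
  by split => /=; rewrite in_itv/=; apply/andP; split; lra.
- rewrite (eq_bigr (fun i => t i - s i))// => i _ /=.
  by rewrite opprD addrACA subrr addr0.
Qed.

(** Each interval ]u, v[ of a disjoint family is cut at [s]: the left parts
    ]min u s, min v s[ and the right parts ]max u s, max v s[, possibly empty,
    are disjoint families in [a, s] and in [s, b]. *)
Lemma abs_cont_cat (a s b : R) (f : R -> R) : a <= s -> s <= b ->
  abs_cont a s f -> abs_cont s b f -> abs_cont a b f.
Proof.
move=> as_ sb f1 f2 e e0; have e20 : 0 < e / 2 by rewrite divr_gt0.
have [d1 d10 H1] := f1 _ e20; have [d2 d20 H2] := f2 _ e20.
exists (Num.min d1 d2); first by rewrite lt_min d10.
move=> m u v uvab uvd; rewrite lt_min => /andP[le1 le2].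
pose u1 i := Num.min (u i) s; pose v1 i := Num.min (v i) s.
pose u2 i := Num.max (u i) s; pose v2 i := Num.max (v i) s.
have uv i : u i <= v i by have [_ []] := uvab i.
have split1 i : v1 i - u1 i <= v i - u i /\ v2 i - u2 i <= v i - u i.
  rewrite /v1 /u1 /v2 /u2; have := uv i.
  have [vs|sv] := leP (v i) s; have [us|su] := leP (u i) s => uvi; split; lra.
have splitf i : `|f (v i) - f (u i)| <=
    `|f (v1 i) - f (u1 i)| + `|f (v2 i) - f (u2 i)|.
  rewrite /v1 /u1 /v2 /u2; have := uv i.
  have [vs|sv] := leP (v i) s; have [us|su] := leP (u i) s => uvi.
  - by rewrite subrr normr0 addr0.
  - by move: (lt_le_trans su uvi); rewrite ltNge vs.
  - by rewrite [leRHS]addrC; apply: le_trans (ler_normD _ _); rewrite addrA subrK.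
  - by rewrite subrr normr0 add0r.
apply: (@le_lt_trans _ _ (\sum_i `|f (v1 i) - f (u1 i)| +
                          \sum_i `|f (v2 i) - f (u2 i)|)).
  by rewrite -big_split /=; apply: ler_sum.
rewrite (splitr e); apply: ltrD.
- apply: H1 => [i|i j /uvd uvij|].
  + have [au [_ vb]] := uvab i.
    by rewrite /u1 /v1 !le_min !ge_min au as_ uv lexx !orbT.
  + apply/seteqP; split => // x [/=].
    rewrite !in_itv/= !lt_min !gt_min => /andP[uix /andP[xvi xs]].
    move=> /andP[ujx /andP[xvj _]]; move: uix ujx.
    rewrite (ltNge s) (ltW xs) !orbF => uix ujx.
    suff : (`]u i, v i[ `&` `]u j, v j[) x by rewrite uvij.
    by split; rewrite /= in_itv/= ?uix ?ujx.
  + by apply: le_lt_trans le1; apply: ler_sum => i _; have [] := split1 i.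
- apply: H2 => [i|i j /uvd uvij|].
  + have [au [_ vb]] := uvab i.
    by rewrite /u2 /v2 !ge_max !le_max vb sb uv lexx !orbT.
  + apply/seteqP; split => // x [/=].
    rewrite !in_itv/= !gt_max !lt_max => /andP[/andP[uix sx] xvi].
    move=> /andP[/andP[ujx _] xvj]; move: xvi xvj.
    rewrite (ltNge x s) (ltW sx) !orbF => xvi xvj.
    suff : (`]u i, v i[ `&` `]u j, v j[) x by rewrite uvij.
    by split; rewrite /= in_itv/= ?uix ?ujx.
  + by apply: le_lt_trans le2; apply: ler_sum => i _; have [] := split1 i.
Qed.

End AbsCont.

(** * Horizontal curves *)

Section Curves.
Context {R : realType} {n r : nat} {M : topologicalType}.
Context {S : smooth_structure R n M} (Q : sub_riemannian S r).
Local Notation mu := (@lebesgue_measure R).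
Implicit Types (c : R -> M) (f : R -> R).

Lemma derivable_shift (k t : R) f :
  derivable (f \o shift k) t 1 = derivable f (t + k) 1.
Proof. by rewrite /derivable /=; under eq_fun do rewrite -addrA. Qed.

Lemma derive1_shift (k t : R) f : derive1 (f \o shift k) t = derive1 f (t + k).
Proof. by rewrite /derive1 /=; under eq_fun do rewrite -addrA. Qed.

(** The velocity is a two-sided derivative, so [c'] has to be a translate of
    [c] on a neighbourhood of [t]. *)
Lemma velocity_shift_near (k t : R) c c' :
  (\forall y \near t, c' y = c (y + k)) ->
  velocity S c' t = velocity S c (t + k).
Proof.
move=> cc'; apply/funext => f; rewrite /velocity; case: asboolP => // _.
rewrite -derive1_shift !derive1E; apply: near_eq_derive.
by apply: filterS cc' => y /= ->.
Qed.

Lemma curve_derivable_shift_near (k t : R) c c' :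
  (\forall y \near t, c' y = c (y + k)) ->
  curve_derivable S c (t + k) -> curve_derivable S c' t.
Proof.
move=> cc' cd f /cd; rewrite -derivable_shift; apply: near_eq_derivable.
by apply: filterS cc' => y /= ->.
Qed.

Lemma W11_sub (a b a' b' : R) c : a <= a' -> b' <= b ->
  W11 Q a b c -> W11 Q a' b' c.
Proof.
move=> aa' bb' [[cc ac] ae]; have sub : `[a', b'] `<=` `[a, b].
  by move=> t /=; rewrite !in_itv/= => /andP[? ?]; apply/andP; split; lra.
split; first split.
- exact: continuous_subspaceW cc.
- by move=> f sf cf; apply: abs_cont_sub (ac f sf cf).
- apply: filterS ae => t H /sub; exact: H.
Qed.

Lemma within_continuous_shift (k a b : R) c :
  {within `[a, b], continuous c} ->
  {within `[a - k, b - k], continuous (c \o shift k)}.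
Proof.
move=> /subspace_continuousP cc; apply/subspace_continuousP => t /= tab.
have tk : `[a, b]%classic (t + k).
  by move: tab; rewrite /= !in_itv/= => /andP[? ?]; apply/andP; split; lra.
have shk : shift k y @[y --> within `[a - k, b - k] (nbhs t)] -->
    within `[a, b] (nbhs (t + k)).
  have ck : y + k @[y --> t] --> t + k.
    by apply: cvgD; [exact: cvg_id|exact: cvg_cst].
  move=> A nA.
  have {}nA : \forall y \near t, `[a, b]%classic (y + k) -> A (y + k).
    exact: ck nA.
  change (\forall y \near t, `[a - k, b - k]%classic y -> A (y + k)).
  apply: filterS nA => y H; rewrite /= in_itv/= => /andP[? ?].
  by apply: H; rewrite /= in_itv/=; apply/andP; split; lra.
exact: cvg_comp shk (cc _ tk).
Qed.

(** [c'] need only be a translate of [c] on the interval: at the end points its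
    velocity is not determined, but they form a null set. *)
Lemma W11_shift (k a b : R) c c' :
  (forall t, a - k <= t <= b - k -> c' t = c (t + k)) ->
  W11 Q a b c -> W11 Q (a - k) (b - k) c'.
Proof.
move=> cc' [[cc ac] ae].
have cc'in t : t \in `[a - k, b - k]%classic -> (c \o shift k) t = c' t.
  by rewrite inE/= in_itv/= => tab; rewrite cc'.
split; first split.
- by apply: subspace_eq_continuous cc'in _; exact: within_continuous_shift.
- move=> f sf cf; apply: eq_abs_cont (abs_cont_shift k (ac f sf cf)) => t tab /=.
  by rewrite cc'.
- apply: filterS3 (ae_neq (a - k)) (ae_neq (b - k)) (ae_shift k ae).
  move=> t ta tb H tab; move: (tab); rewrite in_itv/= => /andP[at_ tb_].
  have tk : t + k \in `[a, b] by rewrite in_itv/=; apply/andP; split; lra.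
  have [cd vD] := H tk.
  have nt : \forall y \near t, c' y = c (y + k).
    have : t \in `]a - k, b - k[.
      by rewrite in_itv/= !lt_neqAle at_ tb_ tb eq_sym ta.
    move=> /near_in_itvoo; apply: filterS => y; rewrite in_itv/=.
    by move=> /andP[? ?]; apply: cc'; apply/andP; split; exact: ltW.
  split; first exact: curve_derivable_shift_near cd.
  by rewrite (velocity_shift_near nt) cc'// at_ tb_.
Qed.

Lemma W11_cat (a s b : R) c : a <= s -> s <= b ->
  W11 Q a s c -> W11 Q s b c -> W11 Q a b c.
Proof.
move=> as_ sb [[c1 ac1] ae1] [[c2 ac2] ae2].
have E : `[a, b]%classic = `[a, s] `|` `[s, b].
  apply/seteqP; split => t /=; rewrite !in_itv/=.
    move=> /andP[at_ tb]; have [ts|st] := leP t s; [left|right].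
      exact/andP.
    by rewrite tb ltW.
  by move=> [] /andP[? ?]; apply/andP; split; lra.
split; first split.
- rewrite E; apply: withinU_continuous => //; exact: interval_closed.
- by move=> f sf cf; apply: (abs_cont_cat as_ sb); [exact: ac1|exact: ac2].
- apply: filterS2 ae1 ae2 => t H1 H2; rewrite in_itv/= => /andP[at_ tb].
  have [ts|st] := leP t s; [apply: H1|apply: H2]; rewrite in_itv/= ?at_ ?tb//.
  by rewrite andbT ltW.
Qed.

Lemma sr_dist0 (x : M) : sr_dist Q x 0.
Proof.
have [U [X [_ Ux [_ fr]]]] := sr_dist_smooth Q x.
rewrite (fr x Ux).1; exists (fun=> 0) => //.
by rewrite big1// => i _; rewrite scale0r.
Qed.

Lemma sr_norm0 (x : M) : sr_norm Q x 0 = 0.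
Proof.
have D0 := sr_dist0 x.
have := sr_inner_lin 1 D0 D0 D0; rewrite scale1r addr0 mul1r.
move=> /eqP; rewrite -subr_eq subrr eq_sym => /eqP e0.
by rewrite /sr_norm e0 sqrtr0.
Qed.

Lemma velocity_cst (x : M) (t : R) : velocity S (fun=> x) t = 0.
Proof.
apply/funext => f; rewrite /velocity; case: asboolP => // _.
by rewrite derive1_cst.
Qed.

Lemma W11_cst (a b : R) (x : M) : W11 Q a b (fun=> x).
Proof.
split; first split.
- exact: cst_continuous.
- move=> f _ _ e e0; exists 1 => // m s t _ _ _.
  by rewrite big1// => i _ /=; rewrite subrr normr0.
- apply: aeW => t _; split; first by move=> f _; exact: derivable_cst.
  by rewrite velocity_cst; exact: sr_dist0.
Qed.

End Curves.

(** * The exponential weight *)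

Section ExpWeight.
Context {R : realType}.
Variables (lambda : R) (lambda_gt0 : 0 < lambda).
Local Notation mu := (@lebesgue_measure R).
Local Open Scope ereal_scope.

Lemma measurable_expRM (k : R) :
  measurable_fun setT (fun t : measurableTypeR R => expR (k * t)%R).
Proof.
by apply: measurableT_comp => //; apply: measurable_funM => //; exact: measurable_cst.
Qed.

Lemma integral_expR_Ny0 :
  \int[mu]_(t in `]-oo, 0%R]) (expR (lambda * t)%R)%:E = (lambda^-1)%:E.
Proof.
pose f (t : R) := (expR (- lambda * t)%R)%:E.
have mf : measurable_fun setT (f : measurableTypeR R -> \bar R).
  by apply/measurable_EFinP; exact: measurable_expRM.
have f0 t : 0 <= f t by rewrite lee_fin expR_ge0.
have fN : \int[mu]_(t in `]-oo, 0%R]) (expR (lambda * t)%R)%:E =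
    \int[mu]_(t in `[0%R, +oo[) f t.
  rewrite ge0_integration_by_substitution0//; apply: eq_integral => t _.
  by rewrite /f mulrNN.
have := integral_exponential_pdf lambda_gt0.
have -> : \int[mu]_t (exponential_pdf lambda t)%:E =
    \int[mu]_(t in `[0%R, +oo[) (lambda%:E * f t).
  rewrite [RHS]integral_mkcond; apply: eq_integral => t _.
  by rewrite /exponential_pdf !patchE; case: ifPn.
rewrite ge0_integralZl//; last 2 first.
- exact: measurable_funTS.
- by rewrite lee_fin ltW.
rewrite -fN => e1; rewrite -[LHS]mul1e -(@mulVf _ lambda) ?gt_eqF//.
by rewrite EFinM -muleA e1 mule1.
Qed.

Lemma integrable_expR_Ny0 :
  mu.-integrable `]-oo, 0%R] (fun t => (expR (lambda * t)%R)%:E).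
Proof.
apply/integrableP; split.
  by apply: measurable_funTS; apply/measurable_EFinP; exact: measurable_expRM.
under eq_integral => t _ do rewrite gee0_abs ?lee_fin ?expR_ge0//.
by rewrite integral_expR_Ny0 ltry.
Qed.

Lemma integral_cst_expR_Ny0 (m : R) :
  \int[mu]_(t in `]-oo, 0%R]) (expR (lambda * t) * m)%:E = (m / lambda)%:E.
Proof.
rewrite (_ : (m / lambda)%:E = m%:E * (lambda^-1)%:E)// -integral_expR_Ny0.
rewrite -integralZl//; last exact: integrable_expR_Ny0.
by apply: eq_integral => t _; rewrite mulrC EFinM.
Qed.

End ExpWeight.

(** * The discounted action *)

Section Value.
Context {R : realType} {n r : nat} {M : topologicalType}.
Context {S : smooth_structure R n M} (Q : sub_riemannian S r).
Variable L : M -> ((M -> R) -> R) -> R.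
Variables (lambda : R) (lambda_gt0 : 0 < lambda).
Local Notation mu := (@lebesgue_measure R).
Local Open Scope ereal_scope.
Implicit Types (c : R -> M) (m : R).

Let integrand c (t : R) : \bar R := (expR (lambda * t) * L (c t) (velocity S c t))%:E.

(** The half-line is the union of countably many compact intervals. *)
Lemma ae_horizontal c : W11_loc Q `]-oo, 0%R] c ->
  {ae mu, forall t, (t <= 0)%R -> sr_dist Q (c t) (velocity S c t)}.
Proof.
move=> Wc; have : {ae mu, forall t, forall k : nat, t \in `[(- k.+1%:R)%R, 0%R] ->
    curve_derivable S c t /\ sr_dist Q (c t) (velocity S c t)}.
  apply: (@ae_foralln _ _ _ mu) => k; apply: (Wc _ _ _ _).2.
    by rewrite oppr_lt0 ltr0n.
  by move=> t /=; rewrite !in_itv/= => /andP[].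
apply: filterS => t H t0; apply: (H (Num.truncn (- t)%R) _).2.
by rewrite in_itv/= t0 andbT lerNl ltW// truncnS_gt.
Qed.

Section LowerBound.
Variables (m : R) (mL : forall x v, sr_dist Q x v -> (m <= L x v)%R).

Lemma le_discounted_action c : W11_loc Q `]-oo, 0%R] c ->
  (m / lambda)%:E <= discounted_action S L lambda `]-oo, 0%R] c.
Proof.
move=> /ae_horizontal ae; rewrite -integral_cst_expR_Ny0//.
apply: ae_le_integral; apply: filterS ae => t H /=; rewrite in_itv/= => t0.
by rewrite lee_fin ler_pM2l ?expR_gt0// mL//; exact: H.
Qed.

(** A lower bound [m] of [L] bounds the negative part of the integrand by
    [`|m| * expR (lambda * t)]. *)
Lemma discounted_action_neg_lty c : W11_loc Q `]-oo, 0%R] c ->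
  \int[mu]_(t in `]-oo, 0%R]) ((integrand c)^\- t) < +oo.
Proof.
move=> /ae_horizontal ae.
apply: (@le_lt_trans _ _ (`|m| / lambda)%:E); last exact: ltry.
rewrite -integral_cst_expR_Ny0//.
apply: ae_le_integral; apply: filterS ae => t H /=; rewrite in_itv/= => t0.
rewrite funenegE ge_max -EFinN !lee_fin mulr_ge0 ?expR_ge0// andbT.
rewrite -mulrN ler_pM2l ?expR_gt0// lerNl.
by apply: (le_trans _ (mL (H t0))); rewrite lerNl ler_normr lexx orbT.
Qed.

Lemma le_value_function x :
  (m / lambda)%:E <= value_function Q L lambda x.
Proof.
by apply: le_ereal_inf_tmp => _ [c [Wc _] <-]; exact: le_discounted_action.
Qed.

End LowerBound.

Lemma value_function_le x :
  value_function Q L lambda x <= (L x 0 / lambda)%:E.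
Proof.
apply: ereal_inf_lbound; exists (fun=> x).
  by split => // a b _ _; exact: W11_cst.
rewrite /discounted_action -integral_cst_expR_Ny0//; apply: eq_integral => t _.
by rewrite velocity_cst.
Qed.

(** The dynamic programming competitor: [gamma] on its half-line, then [alpha],
    both translated so that the curve ends at time 0. *)
Definition concat (a b : R) (alpha gamma : R -> M) (t : R) :=
  if (t <= a - b)%R then gamma (t + (b - a))%R else alpha (t + b)%R.

Lemma W11_loc_concat (a b : R) alpha gamma : (a < b)%R ->
  W11 Q a b alpha -> W11_loc Q `]-oo, 0%R] gamma -> gamma 0%R = alpha a ->
  W11_loc Q `]-oo, 0%R] (concat a b alpha gamma).
Proof.
move=> ab Wa Wg ga p q pq pq0.
have q0 : (q <= 0)%R.
  by have := pq0 q; rewrite /= !in_itv/= lexx ltW//; exact.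
pose p' := Num.min p (a - b - 1)%R.
have p's : (p' < a - b)%R by rewrite gt_min; apply/orP; right; lra.
apply: (@W11_sub _ _ _ _ _ _ p' 0%R) => //; first by rewrite ge_min lexx.
apply: (@W11_cat _ _ _ _ _ _ p' (a - b)%R 0%R); [exact: ltW|lra| |].
- have := @W11_shift _ _ _ _ _ Q (b - a)%R (p' + (b - a))%R 0%R gamma
    (concat a b alpha gamma).
  rewrite addrK sub0r opprB; apply.
    by move=> t /andP[_ ts]; rewrite /concat ts.
  apply: Wg; first lra.
  by move=> t /=; rewrite !in_itv/= => /andP[].
- have := @W11_shift _ _ _ _ _ Q b a b alpha (concat a b alpha gamma).
  rewrite subrr; apply => // t /andP[st t0]; rewrite /concat.
  case: ifPn => // ts; have -> : t = (a - b)%R by lra.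
  by rewrite addrA subrK subrr ga.
Qed.

(** The weight satisfies
    [expR (lambda * t) = expR (- (lambda * k)) * expR (lambda * (t + k))]. *)
Lemma discounted_action_shift (k : R) (I : set R) c c' :
  {ae mu, forall t, (shift k @^-1` I) t ->
     \forall y \near t, c' y = c (y + k)%R} ->
  \int[mu]_(t in shift k @^-1` I) ((integrand c')^\- t) < +oo ->
  \int[mu]_(t in shift k @^-1` I) integrand c' t =
    (expR (- (lambda * k)))%:E * discounted_action S L lambda I c.
Proof.
move=> cc' nfin.
have FE : {ae mu, forall t, (shift k @^-1` I) t ->
    integrand c' t = (expR (- (lambda * k)))%:E * integrand c (t + k)%R}.
  apply: filterS cc' => t H It; have {}H := H It.
  rewrite /integrand (velocity_shift_near H) (nbhs_singleton H) -EFinM mulrA -expRD.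
  by congr (expR _ * _)%:E; rewrite mulrDr addrCA addNr addr0.
rewrite (ae_eq_lower_integral FE) lower_integral_affine ?expR_gt0//.
apply: le_lt_trans nfin; rewrite le_eqVlt; apply/orP; left; apply/eqP.
by apply: ae_eq_lower_integral; apply: filterS FE => t H It; rewrite !funenegE H.
Qed.

Lemma discounted_action_concat (a b : R) alpha gamma : (a < b)%R ->
  \int[mu]_(t in `]-oo, 0%R]) ((integrand (concat a b alpha gamma))^\- t) < +oo ->
  discounted_action S L lambda `]-oo, 0%R] (concat a b alpha gamma) =
    (expR (- (lambda * (b - a))))%:E *
      discounted_action S L lambda `]-oo, 0%R] gamma
    + (expR (- (lambda * b)))%:E * discounted_action S L lambda `[a, b] alpha.
Proof.
set c := concat _ _ _ _ => ab nfin.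
have IE : `]-oo, 0%R]%classic = `]-oo, (a - b)%R] `|` `](a - b)%R, 0%R].
  by rewrite -itv_bndbnd_setU// bnd_simp; lra.
have nle I : I `<=` `]-oo, 0%R] -> \int[mu]_(t in I) ((integrand c)^\- t) < +oo.
  move=> I0; apply: le_lt_trans nfin; rewrite integral_mkcond [leRHS]integral_mkcond.
  apply: ge0_le_lower_integral => t; first exact: erestrict_ge0.
  rewrite !patchE; have [/set_mem/I0/mem_set ->//|_] := boolP (t \in I).
  case: ifPn => // _. exact: funeneg_ge0.
rewrite {1}/discounted_action -/(integrand c) [in LHS]IE.
rewrite lower_integral_setU//; last 2 first.
- apply/disj_setPS => t [/=]; rewrite !in_itv/= => ts /andP[st _]; move: ts.
  by rewrite leNgt st.
- by rewrite -IE.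
congr (_ + _).
- have pre : `]-oo, (a - b)%R]%classic = shift (b - a)%R @^-1` `]-oo, 0%R].
    by apply/seteqP; split => t /=; rewrite !in_itv/=; lra.
  rewrite pre (discounted_action_shift (c := gamma))// -?pre.
  + apply: filterS (ae_neq (a - b)%R) => t ts /=; rewrite in_itv/= => t0.
    have : t \in `]-oo, (a - b)%R[.
      by rewrite in_itv/= lt_neqAle ts/=; lra.
    move=> /near_in_itvNyo; apply: filterS => y; rewrite in_itv/= => ys.
    by rewrite /c /concat ltW.
  + by apply: nle; rewrite IE; exact: subsetUl.
- have pre : `](a - b)%R, 0%R]%classic = shift b @^-1` `]a, b].
    by apply/seteqP; split => t /=; rewrite !in_itv/= => /andP[? ?];
      apply/andP; split; lra.
  rewrite /discounted_action -(lower_integral_itv_obnd_cbnd a).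
  rewrite pre -/(discounted_action S L lambda `]a, b] alpha).
  rewrite (discounted_action_shift (c := alpha))// -?pre.
  + apply: aeW => t; rewrite /= in_itv/= => /andP[st _].
    have : t \in `](a - b)%R, +oo[ by rewrite in_itv/= st.
    move=> /near_in_itvoy; apply: filterS => y; rewrite in_itv/= andbT => sy.
    by rewrite /c /concat leNgt sy.
  + by apply: nle; rewrite IE; exact: subsetUr.
Qed.

End Value.

(** * The value function *)

Theorem proposition2 (R : realType) (n r : nat) (M : topologicalType)
    (S : smooth_structure R n M) (Q : sub_riemannian S r)
    (L : M -> ((M -> R) -> R) -> R)
    (L_C2 : lagrangian_C2 Q L)
    (L_superlinear : uniformly_superlinear Q L)
    (L_bounded : uniformly_bounded Q L)
    (L_convex : strictly_convex Q L)
    (lambda : R) (lambda_gt0 : 0 < lambda) :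
  (forall x : M,
     (ereal_inf [set y | exists z v, sr_dist Q z v /\ y = (L z v)%:E]
        <= lambda%:E * value_function Q L lambda x)%E /\
     (lambda%:E * value_function Q L lambda x
        <= ereal_sup [set y | exists z v,
             [/\ sr_dist Q z v, sr_norm Q z v = 0%R & y = (L z v)%:E]])%E) /\
  (forall (a b : R) (alpha : R -> M), a < b -> W11 Q a b alpha ->
     (value_function Q L lambda (alpha b) * (expR (lambda * b))%:E
        - value_function Q L lambda (alpha a) * (expR (lambda * a))%:E
        <= discounted_action S L lambda `[a, b] alpha)%E).
Proof.
(* Superlinearity with slope 0 is a lower bound for [L]. *)
have [C CL0] := L_superlinear 0 (lexx 0).
have CL x v : sr_dist Q x v -> C <= L x v by move/CL0; rewrite mul0r add0r.
have ufin x : value_function Q L lambda x \is a fin_num.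
  rewrite fin_numE; apply/andP; split; apply/eqP => ux.
    by have := le_value_function lambda_gt0 CL x; rewrite ux.
  by have := value_function_le Q L lambda_gt0 x; rewrite ux.
split => [x|a b alpha ab Wa].
- split.
    set m := ereal_inf _.
    have mL z v : sr_dist Q z v -> (m <= (L z v)%:E)%E.
      by move=> Dv; apply: ereal_inf_lbound; exists z, v.
    have mfin : m \is a fin_num.
      rewrite fin_numE; apply/andP; split; apply/eqP => mE.
        have : (C%:E <= m)%E.
          by apply: le_ereal_inf_tmp => _ [z [v [Dv ->]]]; rewrite lee_fin CL.
        by rewrite mE.
      by have := mL _ _ (sr_dist0 Q x); rewrite mE.
    rewrite -(fineK mfin) muleC -lee_pdivrMr//.
    by apply: le_value_function => // z v /mL; rewrite -{1}(fineK mfin) lee_fin.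
  apply: (@le_trans _ _ (L x 0)%:E); last first.
    by apply: ereal_sup_ubound; exists x, 0; split => //;
      [exact: sr_dist0|exact: sr_norm0].
  by rewrite muleC -lee_pdivlMr//; exact: value_function_le.
- set A := discounted_action _ _ _ _ alpha.
  set ua := value_function _ _ _ (alpha a).
  set ub := value_function _ _ _ (alpha b).
  have key gamma : W11_loc Q `]-oo, 0%R] gamma -> gamma 0 = alpha a ->
      (ub <= (expR (- (lambda * (b - a))))%:E *
               discounted_action S L lambda `]-oo, 0%R] gamma
             + (expR (- (lambda * b)))%:E * A)%E.
    move=> Wg ga; have Wc := W11_loc_concat ab Wa Wg ga.
    rewrite -discounted_action_concat//; last first.
      exact: (discounted_action_neg_lty lambda_gt0 CL).
    apply: ereal_inf_lbound; eexists; [split; first exact: Wc|by []].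
    by rewrite /concat ifF ?add0r//; apply/negbTE; rewrite -ltNge; lra.
  have eE (y : R) : expR (- (lambda * (b - a))) * y =
      expR (- (lambda * b)) * (expR (lambda * a) * y).
    by rewrite mulrA -expRD; congr (expR _ * _); lra.
  have eb : expR (- (lambda * b)) * expR (lambda * b) = 1.
    by rewrite expRN mulVf// gt_eqF// expR_gt0.
  have ea0 := expR_gt0 (lambda * a); have eb0 := expR_gt0 (lambda * b).
  have eN0 := expR_gt0 (- (lambda * b)).
  (* [A] is finite: it is not -oo, as the constant curve in [key] would then
     give ub = -oo. *)
  have [A_oo|Afin] := eqVneq A +oo%E; first by rewrite A_oo leey.
  have AN : A != -oo%E.
    apply/eqP => AN; have Wcst : W11_loc Q `]-oo, 0%R] (fun=> alpha a).
      by move=> p q _ _; exact: W11_cst.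
    have := key _ Wcst erefl; rewrite AN mulrNy gtr0_sg// mul1e addeNy leeNy_eq.
    by apply/negP; have := ufin (alpha b); rewrite fin_numE => /andP[].
  have Af : A \is a fin_num by rewrite fin_numE AN Afin.
  have ubf : ub \is a fin_num by exact: ufin.
  rewrite leeBlDr; last by rewrite fin_numM// ufin.
  rewrite -leeBlDl// -(fineK Af) -(fineK ubf).
  rewrite -EFinM -EFinB -lee_pdivrMr//.
  apply: le_ereal_inf_tmp => _ [gamma [Wg ga] <-].
  have := key _ Wg ga.
  have := le_discounted_action lambda_gt0 CL Wg.
  case: (discounted_action _ _ _ _ gamma) => [g _|_ _|//]; last exact: leey.
  rewrite -(fineK Af) -(fineK ubf) -!EFinM -EFinD !lee_fin.
  rewrite eE => H; rewrite ler_pdivrMr// lerBlDr.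
  rewrite -(ler_pM2l eN0) mulrCA eb mulr1 mulrDr (mulrC g).
  exact: H.
Qed.
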